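(* Let $X$ be a metrizable space. Then $C_k(X)$ has a compact resolution swallowing the compact sets of $C_k(X)$ if and only if $X$ is $\sigma$-compact.
   Context: $\mathbb{N}^{\mathbb{N}}$ is ordered coordinatewise: $\alpha\le\beta$ iff $\alpha(n)\le\beta(n)$ for all $n\in\mathbb{N}$. $C_k(X)$ is the space $C(X)$ of all continuous real-valued functions on $X$ with the compact-open topology. A compact resolution in a space $Z$ is a family $\{K_\alpha:\alpha\in\mathbb{N}^{\mathbb{N}}\}$ of compact subsets covering $Z$ with $K_\alpha\subseteq K_\beta$ whenever $\alpha\le\beta$; it swallows the compact sets of $Z$ if every compact $K\subseteq Z$ is contained in some $K_\alpha$. *)

(* Defs.v *)
From HB Require Import structures.
From mathcomp Require Import all_boot all_order all_algebra.
From mathcomp Require Import all_classical all_reals all_analysis.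
Import Order.TTheory GRing.Theory Num.Theory.
Import numFieldNormedType.Exports.

Set Implicit Arguments.
Unset Strict Implicit.
Unset Printing Implicit Defensive.

Local Open Scope classical_set_scope.
Local Open Scope ring_scope.

(* Nonnegativity of [d] follows from the axioms, as in the factory [isMetric]. *)
Definition is_metric (R : realType) (T : Type) (d : T -> T -> R) : Prop :=
  [/\ forall x y, d x y = 0 <-> x = y,
      forall x y, d x y = d y x &
      forall x y z, d x z <= d x y + d y z].

Definition metrizable (R : realType) (X : topologicalType) : Prop :=
  exists2 d : X -> X -> R, is_metric d &
    forall x : X, nbhs x =
      filter_from [set e : R | 0 < e] (fun e => [set y | d x y < e]).

Definition sigma_compact (X : topologicalType) : Prop :=
  exists2 F : nat -> set X,
    (forall n, compact (F n)) & \bigcup_n F n = [set: X].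

(* The carrier is [continuousType X R], which has no canonical topology in the
   library; [initial_topology] gives it the subspace topology inherited from
   [{compact-open, X -> R}]. *)
Definition Ck (X : topologicalType) (R : realType) : Type :=
  initial_topology (id : continuousType X R -> {compact-open, X -> R}).

HB.instance Definition _ (X : topologicalType) (R : realType) :=
  Topological.on (Ck X R).

Definition baire_le (a b : nat -> nat) : Prop := forall n, (a n <= b n)%N.

Definition compact_resolution (Z : topologicalType)
    (K : (nat -> nat) -> set Z) : Prop :=
  [/\ forall a, compact (K a),
      \bigcup_a K a = [set: Z] &
      forall a b, baire_le a b -> K a `<=` K b].

Definition swallows_compacts (Z : topologicalType)
    (K : (nat -> nat) -> set Z) : Prop :=
  forall C : set Z, compact C -> exists a, C `<=` K a.

(* Main.v *)
(* If X is the union of compact sets F_n, then by Ascoli the compact subsets of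
   C_k(X) are swallowed by the sets of functions bounded by a prescribed integer
   on each F_n and equicontinuous, with prescribed moduli, at the points of each
   F_n; these integers form an element of N^N, on which the sets depend
   monotonically.

   Conversely, let D_a be the set of functions lying below some member of K_a.
   For a finite sequence s, call U s-full if every nonnegative continuous
   function supported in U lies in D_a for some a extending s. If (x_n) is a
   closed discrete sequence of points of an s-full open set U, then some x_n has
   an (s,n)-full ball: otherwise glue bumps f_n around x_n that no extension of
   (s,n) dominates; the sum is dominated by some a extending s, hence so is f_n
   for n = a(|s|). Pointwise boundedness of D_a forbids a point from having full
   balls along a whole branch of N^N, so each x is terminal for some s: it has an
   s-full ball but no (s,k)-full one. By the gluing argument the points of a small
   closed ball that have no (s,k)-full ball form a compact set. Countably many
   such sets cover X, because uncountable uniformly separated sets are excluded: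
   their existence would bound infinite subfamilies of a family of functions on an
   initial segment of type omega_1, built from injections of the countable
   segments into N, all of whose infinite subfamilies are unbounded. *)
Require Import Defs.
From mathcomp Require Import all_boot all_order all_algebra.
From mathcomp Require Import all_classical all_reals all_analysis.
From mathcomp Require Import lra wochoice.
Import Order.TTheory GRing.Theory Num.Theory.
Import numFieldNormedType.Exports.

(** * Recursive choice of sequences and of branches of N^N *)

Section Sequences.
Set Implicit Arguments.
Unset Strict Implicit.
Local Open Scope nat_scope.
Local Open Scope classical_set_scope.

Lemma history_choice (T : Type) (P : seq T -> T -> Prop) :
  (forall s, exists x, P s x) ->
  exists u : nat -> T, forall n, P (mkseq u n) (u n).
Proof.
move=> /choice[g gP].
pose h n := iter n (fun s => rcons s (g s)) [::].
exists (g \o h) => n.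
suff -> : mkseq (g \o h) n = h n by exact: gP.
elim: n => [//|n IH].
by rewrite mkseqS IH.
Qed.

Lemma branch_choice (Q : seq nat -> Prop) : Q [::] ->
  (forall s, Q s -> exists k, Q (rcons s k)) ->
  exists a : nat -> nat, forall n, Q (mkseq a n).
Proof.
move=> Q0 QS; have [s|a aP] := @history_choice nat (fun s k => Q s -> Q (rcons s k)).
  have [/QS[k Qk]|nQ] := pselect (Q s); first by exists k.
  by exists 0.
by exists a; elim=> [//|n IH]; rewrite mkseqS; exact: aP.
Qed.

Definition extends (s : seq nat) (a : nat -> nat) := mkseq a (size s) = s.

Lemma extends_rcons s a : extends s a -> extends (rcons s (a (size s))) a.
Proof. by rewrite /extends size_rcons mkseqS => ->. Qed.

Lemma extends_mkseq a b n i : extends (mkseq a n) b -> i < n -> b i = a i.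
Proof.
rewrite /extends size_mkseq => /(congr1 (nth 0 ^~ i)) /= E lt_in.
by rewrite !nth_mkseq in E.
Qed.

(** At coordinate i only the finitely many [b n] with n <= i can differ from [a], so a finite
    maximum bounds them all. *)
Lemma extends_bounded (a : nat -> nat) (b : nat -> nat -> nat) :
  (forall n, extends (mkseq a n) (b n)) ->
  exists c, forall n, baire_le (b n) c.
Proof.
move=> bP; exists (fun i => maxn (a i) (\max_(n < i.+1) b n i)) => n i.
have [lt_in|le_ni] := ltnP i n.
  by rewrite (extends_mkseq (bP n) lt_in) leq_maxl.
by rewrite leq_max (leq_bigmax (Ordinal (le_ni : n < i.+1))) orbT.
Qed.

End Sequences.

(** * Uncountable sets and families unbounded on every infinite subset *)

Section Uncountable.
Set Implicit Arguments.
Unset Strict Implicit.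
Local Open Scope classical_set_scope.

(* An uncountable [D] may have uncountable initial segments; [S] is the first of
   these when there is one. *)
Lemma uncountable_segments (T : choiceType) (D : set T) : ~ countable D ->
  exists lt : T -> T -> Prop, exists S, [/\ S `<=` D, ~ countable S,
    forall x y, x = y \/ lt x y \/ lt y x &
    forall x, S x -> countable [set y | S y /\ lt y x]].
Proof.
move=> Dunc; have [R Rwo] := well_ordering_principle T.
have Ranti : {in predT &, antisymmetric R} := wo_chain_antisymmetric (withinW Rwo).
pose lt x y := R x y /\ x <> y.
have tot x y : x = y \/ lt x y \/ lt y x.
  have [|z [[zA zl] _]] := Rwo (pred2 x y); first by exists x; rewrite !inE eqxx.
  have [->|/eqP nxy] := eqVneq x y; [by left|right].
  have Rx : R z x by apply: zl; rewrite !inE eqxx.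
  have Ry : R z y by apply: zl; rewrite !inE eqxx orbT.
  move: zA; rewrite !inE => /orP[] /eqP E; subst z; [left|right]; split => //.
  by move=> /esym.
have [allc|] := pselect (forall x, D x -> countable [set y | D y /\ lt y x]).
  by exists lt, D; split.
move=> /existsNP[x0 /not_implyP[Dx0 ncx0]].
pose A := [pred x | `[< D x /\ ~ countable [set y | D y /\ lt y x] >] ].
have [|m [[/asboolP[Dm mnc] ml] mu]] := Rwo A; first by exists x0; apply/asboolP.
exists lt, [set y | D y /\ lt y m]; split => //; first by move=> y [].
move=> x [Dx [xm neq_xm]].
have [xc|xnc] := pselect (countable [set y | D y /\ lt y x]).
  by apply: sub_countable xc; apply: subset_card_le => y [[Dy _] yx].
case: neq_xm; apply: Ranti => //; rewrite xm ml//.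
exact/asboolP.
Qed.

Lemma injective_unbounded (u : nat -> nat) (M : nat) :
  injective u -> exists n, (M < u n)%N.
Proof.
move=> uinj; apply: contrapT => /forallNP uM.
have uP (i : 'I_M.+2) : (u i < M.+1)%N by rewrite ltnS leqNgt; apply/negP/uM.
have /leq_card : injective (fun i : 'I_M.+2 => Ordinal (uP i)).
  by move=> i j /(congr1 val)/uinj/val_inj.
by rewrite !card_ord ltnn.
Qed.

(** [e x] injects the countable segment below [x] into the integers. Some [x] in [S] lies above the
    whole sequence, as otherwise countably many countable segments and their end points would cover
    [S]; injectivity makes [e x] unbounded along the sequence. *)
Lemma uncountable_unbounded_family (T : choiceType) (D : set T) :
  ~ countable D -> exists S, exists e : T -> T -> nat,
  [/\ S `<=` D, ~ countable S &
    forall u : nat -> T, (forall n, S (u n)) -> injective u ->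
      exists2 x, S x & forall M, exists n, (M < e x (u n))%N].
Proof.
move=> /uncountable_segments[lt [S [SD Sunc tot Sseg]]].
have /choice[e eP] : forall x, exists f : T -> nat,
    S x -> {in [set y | S y /\ lt y x] &, injective f}.
  move=> x; have [Sx|nSx] := pselect (S x); last by exists (fun=> 0%N).
  by have /countable_injP[f fP] := Sseg x Sx; exists f.
exists S, e; split => // u uS uinj.
have [x [Sx xu]] : exists x, S x /\ forall n, lt (u n) x.
  apply: contrapT => /forallNP noub; apply: Sunc.
  have : countable (\bigcup_n [set u n] `|` \bigcup_n [set y | S y /\ lt y (u n)]).
    rewrite -bigcup2E; apply: bigcup_countable => // -[|[|//]] _ /=;
      apply: bigcup_countable => // n _.
    exact: Sseg.
  apply: sub_countable; apply: subset_card_le => x Sx.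
  have /not_andP[//|/existsNP[n nlt]] := noub x.
  by have [|[|]] := tot x (u n); [left; exists n|right; exists n|].
exists x => // M.
have /(injective_unbounded M)[n nM] : injective (e x \o u); last by exists n.
by move=> i j /= /(eP x Sx) E; apply: uinj; apply: E; rewrite inE.
Qed.

End Uncountable.

(** * Bump functions, gluing and compactness in a metric space *)

Section Metric.
Set Implicit Arguments.
Unset Strict Implicit.
Local Open Scope classical_set_scope.
Local Open Scope ring_scope.
Context (R : realType) (X : topologicalType) (d : X -> X -> R).
Hypothesis dM : is_metric d.
Hypothesis dN : forall x : X, nbhs x =
  filter_from [set e : R | 0 < e] (fun e => [set y | d x y < e]).

Let dxx x : d x x = 0. Proof. by case: dM => /(_ x x)[_ ->]. Qed.
Let dC x y : d x y = d y x. Proof. by case: dM. Qed.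
Let dD x y z : d x z <= d x y + d y z. Proof. by case: dM. Qed.

Let d_ge0 x y : 0 <= d x y.
Proof. have := dD x y x; rewrite dxx (dC y x); lra. Qed.

Let nbhs_d x e : 0 < e -> nbhs x [set y | d x y < e].
Proof. by move=> e0; rewrite dN; exists e. Qed.

Lemma metric_cvgP (f : X -> R) x : f @ x --> f x <->
  forall e, 0 < e -> exists2 r, 0 < r & forall y, d x y < r -> `|f x - f y| < e.
Proof.
split=> [fx e e0|fx].
  have /cvgrPdist_lt/(_ e e0) := fx.
  by rewrite near_simpl /prop_near1 dN => -[r r0 rf]; exists r.
apply/cvgrPdist_lt => e /fx[r r0 rf].
by rewrite near_simpl /prop_near1 dN; exists r.
Qed.

Lemma metric_near_cvg (f g : X -> R) x r : 0 < r ->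
  (forall y, d x y < r -> g y = f y) -> f @ x --> f x -> g @ x --> g x.
Proof.
move=> r0 gf /metric_cvgP fx; apply/metric_cvgP => e /fx[r' r'0 rf].
exists (Num.min r r'); first by rewrite lt_min r0.
by move=> y; rewrite lt_min => /andP[yr yr']; rewrite !gf ?dxx//; exact: rf.
Qed.

Definition bump x r y : R := Num.max 0 (1 - d x y / r).

Lemma bump_ge0 x r y : 0 <= bump x r y.
Proof. by rewrite /bump le_max lexx. Qed.

Lemma bump_center x r : bump x r x = 1.
Proof. by rewrite /bump dxx mul0r subr0; apply/max_idPr. Qed.

Lemma bump_support x r y : 0 < r -> bump x r y != 0 -> d x y < r.
Proof.
move=> r0; apply: contraNT; rewrite -leNgt => rd; apply/eqP/max_idPl.
by rewrite subr_le0 ler_pdivlMr// mul1r.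
Qed.

Lemma bump_continuous x r : continuous (bump x r).
Proof.
move=> y; apply: (@continuous_max _ _ (cst 0) (fun y => 1 - d x y / r)).
  exact: cvg_cst.
apply: cvgB; first exact: cvg_cst.
apply: cvgMl; apply/metric_cvgP => e e0; exists e => // z yz.
have := dD x y z; have := dD x z y; rewrite (dC z y) ltr_norml => *; lra.
Qed.

(** Indices rather than points are compared, so such a family is injective with closed discrete
    range. *)
Definition discrete_family (I : Type) (x : I -> X) := forall y,
  exists2 e, 0 < e & forall i j, d y (x i) < e -> d y (x j) < e -> i = j.

(** With radii a quarter of the separation, each point has a ball meeting at most one support, so
    the glued function is locally 0 or a single [f i]. The radii depend on [x] alone and precede the
    choice of [f]. *)
Lemma discrete_family_glue (I : Type) (x : I -> X) : discrete_family x ->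
  exists2 r : I -> R, (forall i, 0 < r i) &
  forall f : I -> X -> R, (forall i, continuous (f i)) ->
    (forall i y, f i y != 0 -> d (x i) y < r i) ->
  exists g : X -> R, [/\ continuous g, forall i y, f i y != 0 -> g y = f i y &
    forall y, g y != 0 -> exists i, g y = f i y].
Proof.
move=> xd.
have /choice[e eP] : forall i,
    exists e, 0 < e /\ forall j, i <> j -> e <= d (x i) (x j).
  move=> i; have [e e0 eP] := xd (x i); exists e; split => // j ij.
  by rewrite leNgt; apply/negP => xij; apply: ij; apply: eP => //; rewrite dxx.
exists (fun i => e i / 4) => [i|f fcont fsupp].
  by rewrite divr_gt0//; case: (eP i).
(* With D the distance of the two centers, both supports have radius at most D/4, so D < D/4 + t +
   D/4. *)
have sep y z i j t : d y z < t -> f i y != 0 -> f j z != 0 -> i <> j ->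
    d (x i) (x j) / 2 < t /\ d (x i) y < t / 2.
  move=> yz /fsupp xiy /fsupp xjz ij; have [_ /(_ _ ij) ei] := eP i.
  have [_ /(_ _ (nesym ij)) ej] := eP j.
  have := dD (x i) y (x j); have := dD y z (x j).
  rewrite (dC z) (dC (x j) (x i)) in ej *; lra.
have uniq y i j : f i y != 0 -> f j y != 0 -> i = j.
  move=> fi fj; apply: contrapT => ij.
  have D0 : 0 < d (x i) (x j) / 2.
    by rewrite divr_gt0//; have [ei /(_ _ ij)] := eP i; exact: lt_le_trans.
  by have [] := sep y y i j (d (x i) (x j) / 2) _ fi fj ij; rewrite ?dxx ?ltxx.
have /choice[g gP] : forall y, exists t, (forall i, f i y != 0 -> t = f i y) /\
    (t != 0 -> exists i, t = f i y).
  move=> y; have [[i fi]|nofi] := pselect (exists i, f i y != 0).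
    by exists (f i y); split => [j fj|_]; [rewrite (uniq y i j)|exists i].
  by exists 0; split => [i fi|]; [case: nofi; exists i|rewrite eqxx].
exists g; split; [|by move=> i y; case: (gP y) => + _; apply|by move=> y; case: (gP y)].
move=> y; have [t t0 tP] := xd y.
have t40 : 0 < t / 4 by rewrite divr_gt0.
(* Two supports meeting the t/4-ball around [y] would, by [sep], have both centers within t of [y],
   against [tP]. *)
have [[i [z yz fiz]]|nof] :=
    pselect (exists i, exists2 z, d y z < t / 4 & f i z != 0); last first.
  apply: (metric_near_cvg t40 (f := cst 0)); last exact: cvg_cst.
  move=> z yz; apply: contrapT => /eqP /[dup] gz.
  have [_ /[apply] -[i gzi]] := gP z.
  by apply: nof; exists i, z; rewrite // -gzi.
apply: (metric_near_cvg t40 (f := f i)); last exact: fcont.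
move=> w yw; have [fiw|] := eqVneq (f i w) 0; last by case: (gP w) => + _ => /[apply].
rewrite fiw; apply: contrapT => /eqP gw0; have [_ /(_ gw0)[j gj]] := gP w.
rewrite gj in gw0.
have ij : i <> j by move=> E; rewrite -E fiw eqxx in gw0.
have zw : d z w < t / 2 by have := dD z y w; rewrite (dC z y); lra.
have [_ xiz] := sep z w i j _ zw fiz gw0 ij.
rewrite dC in zw; have [_ xjw] := sep w z j i _ zw gw0 fiz (nesym ij).
apply: ij; apply: tP.
  by have := dD y z (x i); rewrite (dC z); lra.
by have := dD y w (x j); rewrite (dC w); lra.
Qed.

(** The ultrafilter contains the complement of every omitted ball, so the next term can be picked
    outside the balls around all earlier terms. *)
Lemma ultra_avoiding_sequence (F : set_system X) (C : set X) (e : X -> R)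
    (B : nat -> set X) : UltraFilter F -> F C ->
  (forall y, ~ F [set z | d y z < e y]) -> (forall n, F (B n)) ->
  exists u : nat -> X, [/\ forall n, C (u n), forall n, B n (u n) &
    forall i j, (i < j)%N -> e (u i) <= d (u i) (u j)].
Proof.
move=> FU FC Fe FB.
have Favoid (s : seq X) : F [set z | forall y, y \in s -> e y <= d y z].
  elim: s => [|y s IH]; first by apply: filterS filterT => z _ y.
  have [/Fe//|Fy] := in_ultra_setVsetC [set z | d y z < e y] FU.
  apply: filterS2 IH Fy => z zs /= /negP; rewrite -leNgt => yz t.
  by rewrite inE => /orP[/eqP ->|/zs].
have [s|u uP] := @history_choice X (fun s x => [/\ C x, B (size s) x &
    forall y, y \in s -> e y <= d y x]).
  have [x [[Cx Bx] sx]] := filter_ex (filterI (filterI FC (FB (size s))) (Favoid s)).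
  by exists x; split.
exists u; split=> [n|n|i j ij]; first by case: (uP n).
  by case: (uP n); rewrite size_mkseq.
have [_ _] := uP j; apply; apply/mapP; exists i => //.
by rewrite mem_iota.
Qed.

(** A nonconvergent ultrafilter on [C] yields a discrete sequence: a uniformly separated one if all
    balls of some radius are omitted; otherwise one taken from shrinking balls of the ultrafilter
    while escaping the omitted ball around each earlier term. *)
Lemma discrete_compact (C : set X) : closed C ->
  (forall u : nat -> X, (forall n, C (u n)) -> ~ discrete_family u) -> compact C.
Proof.
move=> Ccl Cdisc; rewrite compact_ultra => F FU FC; apply: contrapT => noF.
have /choice[e eP] : forall y, exists e, 0 < e /\ ~ F [set z | d y z < e].
  move=> y; apply: contrapT => /forallNP Fy; apply: noF; exists y.
  have Fcvg : F --> y.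
    move=> V; rewrite dN => -[e e0 eV]; apply: (filterS eV).
    by apply: contrapT => nF; apply: (Fy e).
  split => //; apply: Ccl => V Vy.
  by have [z [Cz Vz]] := filter_ex (filterI FC (Fcvg _ Vy)); exists z.
have Ftb t : 0 < t -> exists y, F [set z | d y z < t].
  move=> t0.
  apply: contrapT => /forallNP Fn.
  have [n'|u [uC _ usep]] :=
    @ultra_avoiding_sequence F C (fun=> t) (fun=> setT) _ FC Fn.
    exact: filterT.
  apply: (Cdisc u) => // y; exists (t / 2); first by rewrite divr_gt0.
  move=> i j yi yj; apply: contrapT => /eqP; rewrite neq_ltn => /orP[] /usep/=.
    by have := dD (u i) y (u j); rewrite (dC _ y); lra.
  by have := dD (u j) y (u i); rewrite (dC _ y); lra.
have /choice[c cP] : forall n, exists y, F [set z | d y z < n.+1%:R^-1].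
  by move=> n; apply: Ftb; rewrite invr_gt0.
have [y|u [uC ucl usep]] := @ultra_avoiding_sequence F C e _ _ FC _ cP.
  by case: (eP y).
apply: (Cdisc u) => // y; have [e0 Fy] := eP y.
have e40 : 0 < e y / 4 by rewrite divr_gt0.
have [N _ Nlarge] := near_infty_natSinv_lt (PosNum e40).
(* A late term closer to [y] would put the small ball around [c n], which belongs to [F], inside the
   omitted ball around [y]. *)
have tail n : (N <= n)%N -> e y / 4 <= d y (u n).
  move=> /Nlarge /= ny; rewrite leNgt; apply/negP => yu; apply: Fy.
  apply: filterS (cP n) => z /= cz.
  have := ucl n; have := dD y (u n) z; have := dD (u n) (c n) z.
  rewrite (dC (u n) (c n)) /=; move: ny cz; move: (n.+1%:R^-1) => t; lra.
have [t t0 tP] : exists2 t, 0 < t & forall n, (n < N)%N -> u n <> y -> t <= d y (u n).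
  elim: (N) => [|m [t t0 tP]]; first by exists 1.
  have [uy|uy] := pselect (u m = y).
    by exists t => // n; rewrite ltnS leq_eqVlt => /orP[/eqP->|/tP].
  exists (Num.min t (d y (u m))).
    rewrite lt_min t0 lt_neqAle d_ge0 andbT eq_sym; apply/eqP => yu0.
    by apply: uy; apply/esym; case: dM => /(_ y (u m))[/(_ yu0)].
  move=> n; rewrite ltnS leq_eqVlt => /orP[/eqP->|/tP/[apply] tn].
    by rewrite ge_min lexx orbT.
  by rewrite ge_min tn.
(* Only terms equal to [y] remain close to it, and two of them would give [e y] <= [d y y] = 0 by
   [usep]. *)
have near_eq n : d y (u n) < Num.min (e y / 4) t -> u n = y.
  rewrite lt_min => /andP[ye yt]; apply: contrapT => uny.
  have [/tail|/tP/(_ uny)] := leqP N n; lra.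
exists (Num.min (e y / 4) t); first by rewrite lt_min e40.
move=> i j /near_eq ui /near_eq uj; apply: contrapT => /eqP; rewrite neq_ltn.
by case/orP=> /usep; rewrite ui uj dxx leNgt e0.
Qed.

(** * Full sets, terminal points and countable covers by compact sets *)

Section Domination.
Context (P : (nat -> nat) -> (X -> R) -> Prop).
Hypothesis P_mono : forall a b f, baire_le a b -> P a f -> P b f.
Hypothesis P_down : forall a f g, (forall x, f x <= g x) -> P a g -> P a f.
Hypothesis P_cover : forall f, continuous f -> exists a, P a f.
Hypothesis P_bdd : forall a x, exists M, forall f, P a f -> f x <= M.

Definition dominated (s : seq nat) (f : X -> R) := exists2 a, extends s a & P a f.

Definition full (s : seq nat) (U : set X) := forall f : X -> R,
  continuous f -> (forall y, 0 <= f y) -> (forall y, f y != 0 -> U y) ->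
  dominated s f.

Definition locally_full s x := exists2 r, 0 < r & full s [set y | d x y < r].

Lemma full_discrete_family s U (x : nat -> X) : full s U ->
  discrete_family x -> (forall n, nbhs (x n) U) ->
  exists n, locally_full (rcons s n) (x n).
Proof.
move=> sU xd xU; apply: contrapT => /forallNP nofull.
have [r r0 glue] := discrete_family_glue xd.
have /choice[f fP] : forall n, exists f : X -> R, [/\ continuous f,
    forall y, 0 <= f y, forall y, f y != 0 -> d (x n) y < r n /\ U y &
    ~ dominated (rcons s n) f].
  move=> n; apply: contrapT => /forallNP nof; apply: (nofull n).
  have := xU n; rewrite dN => -[t t0 tU].
  (* This radius keeps supports both inside [U] and within the range allowed for gluing. *)
  exists (Num.min t (r n)); first by rewrite lt_min t0 r0.
  move=> f fc f0 fU; apply: contrapT => ndom; apply: (nof f); split => // y /fU /=.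
  by rewrite lt_min => /andP[yt ->]; split => //; exact: tU.
have [n|n y|g [gc gf fg]] := glue f; first by case: (fP n).
  by case: (fP n) => _ _ /(_ y) + _ => /[apply] -[].
have g0 y : 0 <= g y.
  have [->//|/fg[n ->]] := eqVneq (g y) 0.
  by case: (fP n) => _ /(_ y).
have gU y : g y != 0 -> U y.
  move=> /[dup] gy0 /fg[n gfn]; rewrite gfn in gy0.
  by case: (fP n) => _ _ /(_ y gy0)[].
have [a sa Pag] := sU g gc g0 gU.
(* Diagonal choice: [a] itself extends [rcons s n] for n = [a (size s)], and [g] lies above this
   [f n]. *)
have [_ f0 _] := fP (a (size s)); apply.
exists a; first exact: extends_rcons.
apply: P_down Pag => y.
by have [->//|/gf ->] := eqVneq (f (a (size s)) y) 0.
Qed.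

(** Otherwise full balls at [x] persist along a branch [a]. The bump of height n at [x] is then
    dominated by some [b n] agreeing with [a] up to n; a common bound of the [b n] contradicts
    [P_bdd] at [x]. *)
Lemma locally_full_terminal x :
  exists s, locally_full s x /\ forall k, ~ locally_full (rcons s k) x.
Proof.
apply: contrapT => /forallNP noterm.
have [||a aP] := @branch_choice (fun s => locally_full s x).
- exists 1 => // f fc _ _; have [a Paf] := P_cover fc.
  by exists a.
- move=> s sx; apply: contrapT => /forallNP nok; exact: (noterm s).
have /choice[b bP] : forall n, exists b, extends (mkseq a n) b /\
    exists2 r, 0 < r & P b (fun y => n%:R * bump x r y).
  move=> n; have [r r0 fulln] := aP n.
  have [||y|b eb Pb] := fulln (fun y => n%:R * bump x r y).
  - by move=> y; apply: cvgMr; exact: bump_continuous.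
  - by move=> y; rewrite mulr_ge0// bump_ge0.
  - by rewrite mulf_eq0 negb_or => /andP[_ /(bump_support r0)].
  - by exists b; split => //; exists r.
have [|c cP] := @extends_bounded a b; first by move=> n; case: (bP n).
have [M MP] := P_bdd c x.
have [_ [r r0 Pb]] := bP (Num.truncn M).+1.
have := MP _ (P_mono (cP _) Pb); rewrite bump_center mulr1.
by rewrite leNgt truncnS_gt.
Qed.

Lemma locally_full_near s x : locally_full s x -> \forall y \near x, locally_full s y.
Proof.
move=> [r r0 rfull]; rewrite /prop_near1 dN.
exists (r / 2); first by rewrite /= divr_gt0.
move=> y /= xy; exists (r / 2); first by rewrite divr_gt0.
move=> f fc f0 fs; apply: rfull => // z /fs /= yz.
have := dD x y z; lra.
Qed.

(** Points of the closed r/2-ball have the full r-ball as a neighbourhood, so [full_discrete_family]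
    rules out discrete sequences; closedness holds because local fullness is an open condition. *)
Lemma terminal_compact s x r : 0 < r -> full s [set y | d x y < r] ->
  compact [set y | d x y <= r / 2 /\ forall k, ~ locally_full (rcons s k) y].
Proof.
move=> r0 sx; apply: discrete_compact.
  rewrite closedE => y ncl; apply: contrapT => yout; apply: ncl.
  have [yr|ry] := leP (d x y) (r / 2); last first.
    rewrite /prop_near1 dN; exists (d x y - r / 2); first by rewrite /= subr_gt0.
    move=> z /= yz [+ _].
    have := dD x z y; rewrite (dC z y); lra.
  have [k ky] : exists k, locally_full (rcons s k) y.
    by apply: contrapT => /forallNP nok; apply: yout.
  apply: filterS (locally_full_near ky) => z kz [_ /(_ k)]; exact.
move=> u uC ud.
have [n|n nfull] := full_discrete_family sx ud.
  rewrite dN; exists (r / 2); first by rewrite /= divr_gt0.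
  move=> y /= uy; have [xu _] := uC n.
  have := dD x (u n) y; lra.
by case: (uC n) => _ /(_ n).
Qed.

(* Otherwise an uncountable family of functions [g z] could be indexed by [a z],
   and the second countability of N^N yields infinitely many [z] whose [a z] have
   a common upper bound. *)
Lemma separated_countable (D : set X) r : 0 < r ->
  (forall x y, D x -> D y -> d x y < r -> x = y) -> countable D.
Proof.
move=> r0 Dsep; apply: contrapT => /uncountable_unbounded_family.
move=> [S [e [SD Sunc Sunb]]].
have Sdisc : discrete_family (fun i : S => val i).
  move=> y; exists (r / 2) => [|i j yi yj]; first by rewrite divr_gt0.
  apply/val_inj/Dsep; [exact/SD/set_valP|exact/SD/set_valP|].
  by have := dD (val i) y (val j); rewrite (dC _ y); lra.
have [t t0 glue] := discrete_family_glue Sdisc.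
have /choice[g gP] : forall z, exists g : X -> R, continuous g /\
    forall x, S x -> (e x z)%:R <= g x.
  (* The successor keeps the bump nonzero at its center, where alone gluing fixes the value of
     [g]. *)
  move=> z; have [i|i y|g [gc gf _]] :=
    glue (fun i y => (e (val i) z).+1%:R * bump (val i) (t i) y).
  - by move=> y; apply: cvgMr; exact: bump_continuous.
  - by rewrite mulf_eq0 negb_or => /andP[_ /bump_support]; apply.
  exists g; split => // x Sx; have := gf (SigSub (mem_set Sx)) x.
  by rewrite /= bump_center mulr1 pnatr_eq0 => ->//; rewrite ler_nat.
have /choice[a aP] : forall z, exists a, P a (g z).
  by move=> z; apply: P_cover; case: (gP z).
(* An uncountable set of indices splits into countably many pieces by the next entry of [a z], so
   one piece is uncountable. *)
have [||b bP] := @branch_choice (fun s => ~ countable [set z | S z /\ extends s (a z)]).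
- by apply: contra_not Sunc; apply: sub_countable; apply: subset_card_le.
- move=> s sunc; apply: contrapT => /forallNP allc; apply: sunc.
  have : countable (\bigcup_k [set z | S z /\ extends (rcons s k) (a z)]).
    by apply: bigcup_countable => // k _; apply: contrapT; exact: allc.
  apply: sub_countable; apply: subset_card_le => z [Sz sz].
  by exists (a z (size s)) => //; split => //; exact: extends_rcons.
have [s|u uP] := @history_choice X (fun s z =>
    [/\ S z, extends (mkseq b (size s)) (a z) & z \notin s]).
  apply: contrapT => /forallNP noz; apply: (bP (size s)).
  have : countable [set` s] by exact/finite_set_countable/finite_seq.
  apply: sub_countable; apply: subset_card_le => z [Sz sz] /=.
  by apply: contrapT => /negP zs; apply: (noz z).
have uS n : S (u n) by case: (uP n).
have uneq i j : (i < j)%N -> u i <> u j.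
  move=> ij uij; have [_ _ /negP] := uP j; apply; rewrite -uij.
  by apply/mapP; exists i => //; rewrite mem_iota.
have uinj : injective u.
  by move=> i j uij; case: (ltngtP i j) => // /uneq //; rewrite uij.
have [|c cP] := @extends_bounded b (a \o u).
  by move=> n; case: (uP n); rewrite size_mkseq.
have [x Sx xunb] := Sunb u uS uinj.
have [M MP] := P_bdd c x.
have [n nM] := xunb (Num.truncn M).
have [_ /(_ x Sx) egx] := gP (u n).
have gM := MP _ (P_mono (cP n) (aP (u n))).
have : M < (e x (u n))%:R by apply: lt_le_trans (truncnS_gt M) _; rewrite ler_nat.
by rewrite ltNge (le_trans egx gM).
Qed.

(** By Zorn: a point of [E] far from all of [D] could be adjoined. The alternative [x = y] covers
    nonpositive [r]. *)
Lemma maximal_separated (E : set X) r : exists D : set X, [/\ D `<=` E,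
  forall x y, D x -> D y -> d x y < r -> x = y &
  forall y, E y -> exists2 x, D x & d x y < r \/ x = y].
Proof.
have [F F_sub Ftot|D [[DE Dsep] Dmax]] := @Zorn_bigcup X (fun D =>
    D `<=` E /\ forall x y, D x -> D y -> d x y < r -> x = y).
  split; first by move=> x [A /F_sub[AE _] /AE].
  move=> x y [A FA Ax] [B FB By].
  have [AB|BA] := Ftot A B FA FB.
    by have [_] := F_sub B FB; apply => //; exact: AB.
  by have [_] := F_sub A FA; apply => //; exact: BA.
exists D; split => // y Ey; apply: contrapT => far.
have far' x : D x -> ~ d x y < r by move=> Dx xy; apply: far; exists x => //; left.
apply: (Dmax (D `|` [set y])).
  rewrite properEneq; split; last exact: subsetUl.
  apply/eqP => E'; apply: far; exists y; last by right.
  by rewrite E'; right.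
split; first by move=> x [/DE|->].
move=> x z [Dx|->] [Dz|->] //; first exact: Dsep.
  by move=> /(far' x Dx).
by rewrite dC => /(far' z Dz).
Qed.

Lemma sigma_compact_bigcup (I : Type) (D : set I) (C : I -> set X) :
  countable D -> (forall i, D i -> compact (C i)) ->
  \bigcup_(i in D) C i = [set: X] -> sigma_compact X.
Proof.
move=> /countable_injP[h hinj] Ccpt CT.
have /choice[F FP] : forall n, exists F, compact F /\
    forall i, D i -> h i = n -> C i `<=` F.
  move=> n; have [[i [Di <-]]|noi] := pselect (exists i, D i /\ h i = n).
    exists (C i); split; first exact: Ccpt.
    by move=> j Dj /hinj ->; rewrite ?inE.
  exists set0; split; first exact: compact0.
  by move=> i Di hi; case: noi; exists i.
exists F; first by move=> n; case: (FP n).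
rewrite -subTset -CT => x [i Di Cx]; exists (h i) => //.
by have [_ /(_ i Di erefl)] := FP (h i); apply.
Qed.

Lemma dominating_family_sigma_compact : sigma_compact X.
Proof.
pose r (n : nat) : R := n.+1%:R^-1.
have r0 n : 0 < r n by rewrite invr_gt0.
pose E (p : seq nat * nat) := [set x | full p.1 [set y | d x y < r p.2] /\
  forall k, ~ locally_full (rcons p.1 k) x].
(* Half the radius of fullness is the separation, so the closed balls of [terminal_compact] around
   [D p] cover [E p]. *)
have /choice[D DP] := fun p => maximal_separated (E p) (r p.2 / 2).
apply: (@sigma_compact_bigcup _ (\bigcup_p [set (p, x) | x in D p]) (fun q =>
  [set y | d q.2 y <= r q.1.2 / 2 /\ forall k, ~ locally_full (rcons q.1.1 k) y])).
- apply: bigcup_countable => // p _; apply: sub_countable (card_image_le _ _) _.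
  have [_ Dsep _] := DP p.
  by apply: separated_countable Dsep; rewrite divr_gt0.
- move=> _ [p _ [x Dx <-]]; apply: terminal_compact => //=.
  by have [/(_ x Dx)[]] := DP p.
- rewrite -subTset => y _.
  have [s [[t t0 tfull] sterm]] := locally_full_terminal y.
  have [N _ /(_ N (leqnn N)) /= Nt] := near_infty_natSinv_lt (PosNum t0).
  have [_ _ /(_ y)[|x Dx xy]] := DP (s, N).
    split => //= f fc f0 fs; apply: tfull => // z /fs /=.
    by move=> yz; apply: lt_trans yz _.
  exists ((s, N), x); first by exists (s, N) => //; exists x.
  split => //=; case: xy => [/ltW//|->].
  by rewrite dxx divr_ge0// ltW.
Qed.

End Domination.

End Metric.

(** * Convergence in C_k(X) and its compact subsets *)

Section FunctionSpace.
Set Implicit Arguments.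
Unset Strict Implicit.
Local Open Scope classical_set_scope.
Local Open Scope ring_scope.
Context (R : realType) (X : topologicalType).

Definition Ck_fun (f : Ck X R) : X -> R := (f : continuousType X R).

Lemma Ck_fun_continuous (f : Ck X R) : continuous (Ck_fun f).
Proof. exact: (@cts_fun _ _ (f : continuousType X R)). Qed.

Definition Ck_of (f : X -> R) (fc : continuous f) : Ck X R :=
  (mkcts fc : continuousType X R).

(** Since [g] is continuous, compact-open convergence to it is uniform convergence on compact
    sets. *)
Lemma Ck_cvgP (F : set_system (Ck X R)) (g : Ck X R) : Filter F ->
  F --> g <-> forall K e, compact K -> 0 < e ->
    F [set f | forall y, K y -> `|Ck_fun g y - Ck_fun f y| < e].
Proof.
move=> FF.
have -> : F --> g <-> {compact-open, Ck_fun @ F --> Ck_fun g}.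
  split => [Fg|Fg A].
    exact: (cvg_trans (cvg_app Ck_fun Fg) (@initial_continuous (continuousType X R)
       {compact-open, X -> R} id g)).
  move=> [_ [[B Bop <-] Bg BA]]; apply: (filterS BA).
  by have := Fg B (open_nbhs_nbhs (conj Bop Bg)).
have -> : {compact-open, Ck_fun @ F --> Ck_fun g} <->
    {family compact, Ck_fun @ F --> Ck_fun g}.
  by apply: compact_open_fam_compactP; exact: Ck_fun_continuous.
have -> : {family compact, Ck_fun @ F --> Ck_fun g} <->
    forall A, compact A -> {uniform A, Ck_fun @ F --> Ck_fun g}.
  exact: fam_cvgP.
split=> [Fg K e cK e0|Fg K cK U].
  have /(_ [set h | forall y, K y -> `|Ck_fun g y - h y| < e]) := Fg K cK.
  apply; apply/uniform_nbhs.
  exists [set xy : R * R | `|xy.1 - xy.2| < e]; split => //.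
  by exists e.
move=> /uniform_nbhs[A [[e /= e0 eA] AU]].
apply: filterS (Fg K e cK e0) => f fe /=; apply: AU => y Ky; apply: eA.
exact: fe.
Qed.

Lemma Ck_eval_cvg (x : X) (F : set_system (Ck X R)) (g : Ck X R) : Filter F ->
  F --> g -> Ck_fun^~ x @ F --> Ck_fun g x.
Proof.
move=> FF /Ck_cvgP Fg; apply/cvgrPdist_lt => e e0.
have := Fg _ _ (@compact_set1 _ x) e0; apply: filterS => f /(_ x erefl).
exact.
Qed.

Lemma compact_Ck_pointwise_bounded (C : set (Ck X R)) (x : X) : compact C ->
  exists M, forall f, C f -> `|Ck_fun f x| <= M.
Proof.
move=> Ccpt; have : compact [set Ck_fun f x | f in C].
  apply: continuous_compact Ccpt => f.
  apply: continuous_subspaceT => {}f; exact: (@Ck_eval_cvg x (nbhs f) f).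
move=> /compact_bounded[M [_ MP]]; exists (M + 1) => f Cf.
by apply: (MP (M + 1)); [rewrite ltrDl|exists f].
Qed.

Context (d : X -> X -> R).
Hypothesis dM : is_metric d.
Hypothesis dN : forall x : X, nbhs x =
  filter_from [set e : R | 0 < e] (fun e => [set y | d x y < e]).

Let dD x y z : d x z <= d x y + d y z. Proof. by case: dM. Qed.

(** An ultrafilter not converging to [x] omits a neighbourhood of [x], hence concentrates on
    finitely many terms. *)
Lemma compact_cvg_range (x : X) (u : nat -> X) : u @ \oo --> x ->
  compact (x |` range u).
Proof.
move=> ux; rewrite compact_ultra => F FU FK.
have [Fx|/existsNP[V /not_implyP[Vx nFV]]] := pselect (F --> x).
  by exists x; split => //; left.
have [N _ NV] := ux V Vx.
have [//|FVC] := in_ultra_setVsetC V FU.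
have FB : F (u @` `I_N).
  apply: filterS (filterI FK FVC) => y [[->|[n _ <-]] nV].
    by case: nV; exact: nbhs_singleton.
  exists n => //=; rewrite ltnNge; apply/negP => Nn; apply: nV; exact: NV.
have : compact (u @` `I_N) by apply: finite_compact; exact: finite_image.
rewrite compact_ultra => /(_ F FU FB)[y [[n _ <-] Fy]].
by exists (u n); split => //; right; exists n.
Qed.

(** Failure gives functions in [C] oscillating by [e] between [x] and points tending to [x]. A
    cluster point of them is uniformly e/4-close to some late one on the compact set of these
    points, and its continuity at [x] leaves an oscillation below 3e/4. *)
Lemma compact_Ck_equicontinuous (C : set (Ck X R)) (x : X) e : compact C -> 0 < e ->
  exists2 r, 0 < r & forall f y, C f -> d x y < r -> `|Ck_fun f x - Ck_fun f y| < e.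
Proof.
move=> Ccpt e0; apply: contrapT => /forall2NP nor.
have /choice[h hP] : forall n : nat, exists fy : Ck X R * X,
    [/\ C fy.1, d x fy.2 < n.+1%:R^-1 & e <= `|Ck_fun fy.1 x - Ck_fun fy.1 fy.2|].
  move=> n; apply: contrapT => /forallNP noh.
  have [] := nor n.+1%:R^-1; first by rewrite invr_gt0 ltr0n.
  apply => f y Cf xy; rewrite ltNge; apply/negP => fe.
  by apply: (noh (f, y)).
pose u n := (h n).2; have ux : u @ \oo --> x.
  move=> V; rewrite dN => -[r r0 rV].
  have [N _ NV] := near_infty_natSinv_lt (PosNum r0).
  exists N => // n Nn; apply: rV; have [_ xu _] := hP n.
  exact: lt_trans xu (NV n Nn).
have [|f [Cf fcl]] := Ccpt (fst \o h @ \oo) _.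
  by exists 0%N => // n _; case: (hP n).
have e40 : 0 < e / 4 by rewrite divr_gt0.
have /Ck_cvgP/(_ _ _ (compact_cvg_range ux) e40) fK := @cvg_id _ (nbhs f).
have /cvgrPdist_lt/(_ _ e40)/ux[N _ NP] := @Ck_fun_continuous f x.
have [|_ [[n Nn <-] fn]] := fcl ((fst \o h) @` [set n | (N <= n)%N]) _ _ fK.
  by exists N => // n Nn; exists n.
have [_ _] := hP n; apply/negP; rewrite -ltNge.
have := NP n Nn; have /= := fn x (or_introl erefl).
have /= := fn (u n) (or_intror (ex_intro2 _ _ n I erefl)).
rewrite -/(u n) !ltr_norml; lra.
Qed.

(** Equicontinuity spreads a bound at [x] to a neighbourhood at the cost of 1; the near-covering
    form of compactness merges the local bounds. *)
Lemma compact_Ck_uniformly_bounded (C : set (Ck X R)) (K : set X) :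
  compact C -> compact K ->
  exists N : nat, forall f x, C f -> K x -> `|Ck_fun f x| <= N%:R.
Proof.
move=> Ccpt /compact_near_coveringP Kcpt.
have [|N _ /(_ N (leqnn N)) NP] := Kcpt nat \oo
    (fun n x => forall f, C f -> `|Ck_fun f x| <= n%:R) _.
  move=> x _; have [r r0 rP] := compact_Ck_equicontinuous x Ccpt (@ltr01 R).
  have [M MP] := compact_Ck_pointwise_bounded x Ccpt.
  exists ([set y | d x y < r], [set n | (Num.truncn (M + 1) < n)%N]).
    split; first by rewrite dN; exists r.
    by exists (Num.truncn (M + 1)).+1.
  move=> [y n] [/= xy Mn] f Cf.
  have Mn' : M + 1 < n%:R by apply: lt_le_trans (truncnS_gt _) _; rewrite ler_nat.
  have := rP f y Cf xy; have := MP f Cf; have := lerB_dist (Ck_fun f y) (Ck_fun f x).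
  rewrite (distrC (Ck_fun f y)); lra.
by exists N => f x Cf Kx; exact: NP.
Qed.

Lemma compact_Ck_uniformly_equicontinuous (C : set (Ck X R)) (K : set X) e :
  compact C -> compact K -> 0 < e ->
  exists N : nat, forall f x y, C f -> K x -> d x y < N.+1%:R^-1 ->
    `|Ck_fun f x - Ck_fun f y| <= e.
Proof.
move=> Ccpt /compact_near_coveringP Kcpt e0.
have [|N _ /(_ N (leqnn N)) NP] := Kcpt nat \oo (fun n x => forall f y, C f ->
    d x y < n.+1%:R^-1 -> `|Ck_fun f x - Ck_fun f y| <= e) _.
  move=> x _; have e20 : 0 < e / 2 by rewrite divr_gt0.
  have [r r0 rP] := compact_Ck_equicontinuous x Ccpt e20.
  have r20 : 0 < r / 2 by rewrite divr_gt0.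
  exists ([set y | d x y < r / 2], [set n | n.+1%:R^-1 < r / 2]).
    split; first by rewrite dN; exists (r / 2).
    exact: near_infty_natSinv_lt (PosNum r20).
  move=> [y n] [/= xy nr] f z Cf yz.
  have xyr : d x y < r by lra.
  have xzr : d x z < r by have := dD x y z; have := lt_trans yz nr; lra.
  have := rP f y Cf xyr; have := rP f z Cf xzr.
  rewrite !ltr_norml ler_norml; lra.
by exists N => f x y Cf Kx; exact: NP.
Qed.

(** * The compact resolution of C_k(X) for sigma-compact X *)

Context (F : nat -> set X).
Hypothesis F_compact : forall n, compact (F n).
Hypothesis F_cover : \bigcup_n F n = [set: X].

(* A single [a : nat -> nat] codes both the bounds on the [F n] and the moduli
   of equicontinuity at the points of [F n], via [pickle]. *)
Definition equicontinuous_family (a : nat -> nat) : set (Ck X R) :=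
  [set f | forall n x, F n x ->
    `|Ck_fun f x| <= (a (pickle (n, @None nat)))%:R /\
    forall m y, d x y < (a (pickle (n, Some m))).+1%:R^-1 ->
      `|Ck_fun f x - Ck_fun f y| <= m.+1%:R^-1].

Lemma equicontinuous_family_mono a b : baire_le a b ->
  equicontinuous_family a `<=` equicontinuous_family b.
Proof.
move=> ab f fa n x Fx; have [fx fxy] := fa n x Fx; split.
  by apply: le_trans fx _; rewrite ler_nat.
move=> m y xy; apply: fxy; apply: lt_le_trans xy _.
by rewrite lef_pV2 ?posrE// ler_nat ltnS.
Qed.

Lemma equicontinuous_family_swallows (C : set (Ck X R)) : compact C ->
  exists a, C `<=` equicontinuous_family a.
Proof.
move=> Ccpt.
have /choice[A AP] := fun n => compact_Ck_uniformly_bounded Ccpt (@F_compact n).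
have /choice[B BP] : forall p : nat * nat, exists N : nat, forall f x y,
    C f -> F p.1 x -> d x y < N.+1%:R^-1 ->
    `|Ck_fun f x - Ck_fun f y| <= p.2.+1%:R^-1.
  move=> p; apply: (compact_Ck_uniformly_equicontinuous Ccpt (@F_compact p.1)).
  by rewrite invr_gt0.
exists (fun k => match @unpickle (nat * option nat)%type k with
  | Some (n, None) => A n
  | Some (n, Some m) => B (n, m)
  | None => 0%N end) => f Cf n x Fx; split; first by rewrite pickleK; exact: AP.
by move=> m y; rewrite pickleK => xy; apply: (BP (n, m)).
Qed.

(** Ascoli by ultrafilters: a pointwise limit exists by compactness of segments, inherits the bounds
    and moduli, and is a uniform limit on compact sets by equicontinuity. *)
Lemma equicontinuous_family_compact a : compact (equicontinuous_family a).
Proof.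
rewrite compact_ultra => U UU UK.
have Fx x : exists n, F n x.
  have [n _ Fnx] : (\bigcup_n F n) x by rewrite F_cover.
  by exists n.
have /choice[g gP] : forall x, exists t : R, forall e, 0 < e ->
    U [set f | `|t - Ck_fun f x| < e].
  move=> x; have [n Fnx] := Fx x.
  pose A : R := (a (pickle (n, @None nat)))%:R.
  have [|t [_ tcl]] := @segment_compact R (- A) A (Ck_fun^~ x @ U) _.
    apply: (@filterS _ U _ (equicontinuous_family a)) => // f fa.
    have [+ _] := fa n x Fnx.
    by rewrite /= in_itv/= ler_norml.
  exists t => e e0; pose V := [set f | `|t - Ck_fun f x| < e].
  (* For an ultrafilter a cluster value is a limit: the complement of [V] cannot belong to [U]. *)
  have [//|nU] := in_ultra_setVsetC V UU.
  have [|_ [[f nf <-] fe]] :=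
      tcl (Ck_fun^~ x @` (~` V)) _ _ (nbhsx_ballx t e e0).
    by apply: (@filterS _ U _ (~` V)) => // f nf; exists f.
  by case: nf.
have gle x y c : (forall f, equicontinuous_family a f ->
    `|Ck_fun f x - Ck_fun f y| <= c) -> `|g x - g y| <= c.
  move=> fc; rewrite leNgt; apply/negP => gxy.
  (* Half the excess over [c], so that e + c + e is exactly the distance to be beaten. *)
  pose e : R := (`|g x - g y| - c) / 2.
  have e0 : 0 < e by rewrite divr_gt0// subr_gt0.
  have [f [[fU fx] fy]] := filter_ex (filterI (filterI UK (gP x e e0)) (gP y e e0)).
  have fxy := fc f fU.
  have : `|g x - g y| < e + c + e; last by rewrite /e; lra.
  have -> : g x - g y =
      (g x - Ck_fun f x) + (Ck_fun f x - Ck_fun f y) + (Ck_fun f y - g y) by lra.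
  apply: le_lt_trans (ler_normD _ _) _; apply: ltr_leD; last first.
    by rewrite distrC ltW.
  by apply: le_lt_trans (ler_normD _ _) _; apply: ltr_leD.
have gbd n x m y : F n x -> d x y < (a (pickle (n, Some m))).+1%:R^-1 ->
    `|g x - g y| <= m.+1%:R^-1.
  by move=> Fnx xy; apply: gle => f fa; have [_] := fa n x Fnx; apply.
have equic x e : 0 < e -> exists2 r, 0 < r & forall y, d x y < r ->
    `|g x - g y| < e /\
    forall f, equicontinuous_family a f -> `|Ck_fun f x - Ck_fun f y| < e.
  move=> e0; have [n Fnx] := Fx x.
  have [m _ /(_ m (leqnn m)) /= me] := near_infty_natSinv_lt (PosNum e0).
  exists (a (pickle (n, Some m))).+1%:R^-1 => [|y xy]; first by rewrite invr_gt0.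
  split=> [|f fa]; first exact: le_lt_trans (gbd n x m y Fnx xy) me.
  by apply: le_lt_trans me; have [_] := fa n x Fnx; apply.
have gc : continuous g.
  move=> x; apply/(metric_cvgP dN) => e /(equic x)[r r0 rP].
  by exists r => // y /rP[].
exists (Ck_of gc); split.
  move=> n x Fnx; split; last by move=> m y; exact: gbd.
  rewrite leNgt; apply/negP => gx.
  set A : R := (X in X < _) in gx.
  have e0 : 0 < `|g x| - A by rewrite subr_gt0.
  have [f [fU fx]] := filter_ex (filterI UK (gP x _ e0)).
  have [+ _] := fU n x Fnx; rewrite -/A.
  by move: fx => /=; have := lerB_dist (g x) (Ck_fun f x); lra.
apply/Ck_cvgP => K e Kcpt e0.
(* Near-covering with [U] as parameter filter: it suffices to control [f] near each point of [K] for
   [U]-most [f]. *)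
have /compact_near_coveringP cover := Kcpt.
apply: (cover _ U (fun f y => `|g y - Ck_fun f y| < e)) => x _.
have e30 : 0 < e / 3 by rewrite divr_gt0.
have [r r0 rP] := equic x _ e30.
exists ([set y | d x y < r],
        equicontinuous_family a `&` [set f | `|g x - Ck_fun f x| < e / 3]).
  split; first by rewrite dN; exists r.
  by apply: filterI => //; exact: gP.
move=> [y f] [/= /rP[gxy /(_ f) fxy] [/fxy]].
by rewrite !ltr_norml in gxy *; lra.
Qed.

Lemma equicontinuous_family_resolution :
  compact_resolution equicontinuous_family /\ swallows_compacts equicontinuous_family.
Proof.
split; last exact: equicontinuous_family_swallows.
split; [exact: equicontinuous_family_compact| |exact: equicontinuous_family_mono].
rewrite -subTset => f _.
by have [a /(_ f erefl)] := equicontinuous_family_swallows (@compact_set1 _ f);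
  exists a.
Qed.

End FunctionSpace.

Theorem corollary2p10 (R : realType) (X : topologicalType)
    (hX : metrizable R X) :
  (exists K : (nat -> nat) -> set (Ck X R),
      compact_resolution K /\ swallows_compacts K)
  <-> sigma_compact X.
Proof.
have [d dM dN] := hX; split; last first.
  by move=> [F Fcpt Fcov]; exists (equicontinuous_family d F);
  exact: equicontinuous_family_resolution.
move=> [K [[Kcpt Kcov Kmono] _]].
apply: (dominating_family_sigma_compact dM dN
  (P := fun a f => exists2 g, K a g & forall x, (f x <= Ck_fun g x)%R)).
- by move=> a b f ab [g Kag fg]; exists g => //; exact: Kmono Kag.
- move=> a f g fg [h Kah gh]; exists h => // x; exact: le_trans (gh x).
- move=> f fc; have [a _ Ka] : (\bigcup_a K a)%classic (Ck_of fc) by rewrite Kcov.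
  by exists a, (Ck_of fc).
- move=> a x; have [M MP] := compact_Ck_pointwise_bounded x (Kcpt a).
  exists M => f [g Kag fg]; apply: le_trans (fg x) _.
  by apply: le_trans (ler_norm _) _; exact: MP.
Qed.
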